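(* Let $n\ge1$ and let $P\colon\mathbb{R}\to\mathbb{R}$ be a trigonometric polynomial of degree $n$, with $2n$ distinct zeroes $x_1,\dots,x_{2n}$ in $[0,2\pi)$. Then: (i) $$\sup_{x\in[0,2\pi)}\sum_{k=1}^{2n}\frac{|P(x)|}{|P'(x_k)|}\ge2.$$ (ii) $$\int_0^{2\pi}\sum_{k=1}^{2n}\frac{|P(x)|}{|P'(x_k)|}\,dx\ge8.$$
   Context: A (real) trigonometric polynomial of degree $n$ is a not identically zero function $P(x)=a_0+\sum_{j=1}^n(a_j\cos(jx)+b_j\sin(jx))$ with real coefficients $a_0,\dots,a_n,b_1,\dots,b_n$. *)

(* Defs.v *)
From Stdlib Require Import Reals.
From Coquelicot Require Import Coquelicot.
Open Scope R_scope.

(* "Of degree n" only bounds the frequencies by n: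
   the coefficients a n and b n are allowed to vanish. *)
Definition trig_poly_of_degree (n : nat) (P : R -> R) : Prop :=
  (exists a b : nat -> R, forall x : R,
      P x = a 0%nat
            + sum_n_m (fun j => a j * cos (INR j * x) + b j * sin (INR j * x))
                      1 n)
  /\ (exists x : R, P x <> 0).

Definition node_sum (n : nat) (P : R -> R) (z : nat -> R) (x : R) : R :=
  sum_n_m (fun k => Rabs (P x) / Rabs (Derive P (z k))) 1 (2 * n).

(* Main.v *)
(** M. Riesz' interpolation formula writes the derivative of a trigonometric
polynomial [f] of degree [n] as
[f'(x) = 1/(2n) * sum_{k=1}^n w_k (f(x + t_k) - f(x - t_k))] with
[t_k = (2k-1) pi / (2n)] and [sum |w_k| = n^2]. Hence Bernstein's inequality,
with constant [n], in the sup norm and in [L^1].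

For (i), the sup norm version gives [|P'(x_k)| <= n M] with [M = sup |P|], so the
sum of the [1 / |P'(x_k)|] is at least [2n / (n M) = 2 / M].

For (ii), by Rolle [P'] vanishes between cyclically consecutive zeros of [P], so
[2 * sum |P'(x_k)| <= int |P''| <= n^2 int |P|], and by the inequality of the
arithmetic and harmonic means [sum 1 / |P'(x_k)| >= 4 n^2 / sum |P'(x_k)|].

Since [P] has at most [2n] zeros with multiplicity, all [P'(x_k)] are nonzero. *)

Require Import Defs.
From Stdlib Require Import Reals Lra Lia List Permutation Sorted.
From Coquelicot Require Import Coquelicot.
Open Scope R_scope.

(** * Zeros of trigonometric polynomials *)

(* Homogeneous polynomials of degree [m] in [cos (x/2)] and [sin (x/2)], in Horner
   form: the coefficient [b] is [f 0], so that [f 0 = 0] lets one factor out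
   [sin (x/2)]. *)
Inductive half_form : nat -> (R -> R) -> Prop :=
| half_form_O (c : R) (f : R -> R) :
    (forall x, f x = c) -> half_form 0 f
| half_form_S (m : nat) (b : R) (g f : R -> R) :
    half_form m g ->
    (forall x, f x = sin (x / 2) * g x + b * cos (x / 2) ^ S m) ->
    half_form (S m) f.

Lemma half_form_ext (m : nat) (f g : R -> R) :
  (forall x, f x = g x) -> half_form m f -> half_form m g.
Proof.
  intros E H; destruct H as [c f Hf | m b h f Hh Hf].
  - apply half_form_O with c; intros x; now rewrite <- E.
  - apply half_form_S with b h; auto; intros x; now rewrite <- E.
Qed.

Lemma half_form_plus (m : nat) (f g : R -> R) :
  half_form m f -> half_form m g -> half_form m (fun x => f x + g x).
Proof.
  intros H; revert g; induction H as [c f Hf | m b h f Hh IH Hf]; intros g Hg.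
  - inversion Hg as [c' g' Hg' |]; subst.
    apply half_form_O with (c + c'); intros x; now rewrite Hf, Hg'.
  - inversion Hg as [| m' b' h' g' Hh' Hg']; subst.
    apply half_form_S with (b + b') (fun x => h x + h' x); auto.
    intros x; rewrite Hf, Hg'; ring.
Qed.

Lemma half_form_scal (m : nat) (f : R -> R) (r : R) :
  half_form m f -> half_form m (fun x => r * f x).
Proof.
  induction 1 as [c f Hf | m b h f Hh IH Hf].
  - apply half_form_O with (r * c); intros x; now rewrite Hf.
  - apply half_form_S with (r * b) (fun x => r * h x); auto.
    intros x; rewrite Hf; ring.
Qed.

Lemma half_form_mul_sin (m : nat) (f : R -> R) :
  half_form m f -> half_form (S m) (fun x => sin (x / 2) * f x).
Proof. intros H; apply half_form_S with 0 f; auto; intros x; ring. Qed.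

(** The factor [cos (x / 2)] passes into the Horner quotient and raises the power attached to [b] by
    one. For a constant [c] the quotient is 0. *)
Lemma half_form_mul_cos (m : nat) (f : R -> R) :
  half_form m f -> half_form (S m) (fun x => cos (x / 2) * f x).
Proof.
  induction 1 as [c f Hf | m b h f Hh IH Hf].
  - apply half_form_S with c (fun _ => 0); [now apply half_form_O with 0 |].
    intros x; rewrite Hf; ring.
  - apply half_form_S with b (fun x => cos (x / 2) * h x); auto.
    intros x; rewrite Hf; simpl; ring.
Qed.

(** By the addition formulas, the cosine and sine of [(x + y) / 2] are linear combinations of those
    of [x / 2], and such a substitution preserves homogeneity. This allows any zero to be moved to
    the origin. *)
Lemma half_form_shift (m : nat) (f : R -> R) (y : R) :
  half_form m f -> half_form m (fun x => f (x + y)).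
Proof.
  induction 1 as [c f Hf | m b h f Hh IH Hf].
  - apply half_form_O with c; auto.
  - assert (Hp : forall k, half_form k (fun x => cos ((x + y) / 2) ^ k)).
    { induction k as [| k IHk]; [now apply half_form_O with 1 |].
      apply half_form_ext with
        (fun x => cos (y / 2) * (cos (x / 2) * cos ((x + y) / 2) ^ k)
                  + (- sin (y / 2)) * (sin (x / 2) * cos ((x + y) / 2) ^ k)).
      - intros x; replace ((x + y) / 2) with (x / 2 + y / 2) by field.
        simpl; rewrite cos_plus; ring.
      - apply half_form_plus; apply half_form_scal;
          [now apply half_form_mul_cos | now apply half_form_mul_sin]. }
    apply half_form_ext with
      (fun x => (cos (y / 2) * (sin (x / 2) * h (x + y))
                 + sin (y / 2) * (cos (x / 2) * h (x + y)))
                + b * cos ((x + y) / 2) ^ S m).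
    + intros x; rewrite Hf.
      replace (sin ((x + y) / 2)) with (sin (x / 2 + y / 2)) by (f_equal; field).
      rewrite sin_plus; ring.
    + apply half_form_plus; [apply half_form_plus |]; apply half_form_scal; auto;
        [now apply half_form_mul_sin | now apply half_form_mul_cos].
Qed.

(** After translation of [y] to the origin, the Horner form evaluated at 0 reads [b = 0], which
    leaves only the multiple of the sine. *)
Lemma half_form_factor (m : nat) (f : R -> R) (y : R) :
  half_form (S m) f -> f y = 0 ->
  exists g, half_form m g /\ forall x, f x = sin ((x - y) / 2) * g x.
Proof.
  intros H Hy.
  assert (Hs := half_form_shift _ _ y H).
  inversion Hs as [| m' b g f' Hg Hf]; subst.
  exists (fun x => g (x + - y)); split; [now apply half_form_shift |].
  assert (Hb : b = 0).
  { specialize (Hf 0); rewrite Rplus_0_l, Hy in Hf.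
    replace (0 / 2) with 0 in Hf by field.
    rewrite sin_0, cos_0, pow1 in Hf; lra. }
  intros x; specialize (Hf (x - y)).
  replace (x - y + y) with x in Hf by ring.
  rewrite Hf, Hb; unfold Rminus; ring.
Qed.

(** A nonzero form of degree [m] has at most [m] zeros modulo [2 * PI]: each zero splits off a sine
    factor that does not vanish at the others, so these remain zeros of the quotient. Nonvanishing
    of [sin ((y' - y) / 2)] encodes distinctness modulo [2 * PI]. *)
Lemma half_form_eq_0 (m : nat) (f : R -> R) (l : list R) :
  half_form m f -> length l = S m ->
  ForallOrdPairs (fun y y' => sin ((y' - y) / 2) <> 0) l ->
  List.Forall (fun y => f y = 0) l -> forall x, f x = 0.
Proof.
  revert f l; induction m as [| m IH]; intros f l H Hl Hd Hz x;
    destruct l as [| y l]; try discriminate;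
    inversion Hz as [| ? ? Hy Hz']; subst.
  - inversion H as [c f' Hf |]; subst; now rewrite Hf, <- (Hf y).
  - destruct (half_form_factor _ _ _ H Hy) as (g & Hg & Hf).
    inversion Hd as [| ? ? Hd1 Hd2]; subst.
    rewrite Hf, (IH g l); auto; try ring.
    rewrite Forall_forall in *; intros y' Hy'.
    specialize (Hz' y' Hy'); rewrite Hf in Hz'.
    apply Rmult_integral in Hz'; destruct Hz' as [Hz' |]; auto.
    now elim (Hd1 y' Hy').
Qed.

Lemma half_form_ex_derive (m : nat) (f : R -> R) (x : R) :
  half_form m f -> ex_derive f x.
Proof.
  induction 1 as [c f Hf | m b h f Hh IH Hf].
  - apply ex_derive_ext with (fun _ => c); auto; apply ex_derive_const.
  - apply ex_derive_ext with (fun x => sin (x / 2) * h x + b * cos (x / 2) ^ S m);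
      auto.
    auto_derive; auto.
Qed.

(** With [g] the quotient of [f] by [sin ((x - y) / 2)], the derivative of [f] at [y] is [g y / 2].
    Were it 0, [g] of degree [m] would vanish at the [m + 1] points of [y :: l], hence everywhere,
    and so would [f]. *)
Lemma half_form_simple_zero (m : nat) (f : R -> R) (y : R) (l : list R) :
  half_form (S m) f -> length l = m ->
  ForallOrdPairs (fun y y' => sin ((y' - y) / 2) <> 0) (y :: l) ->
  List.Forall (fun y => f y = 0) (y :: l) ->
  (exists x, f x <> 0) -> Derive f y <> 0.
Proof.
  intros H Hl Hd Hz (x & Hx) H0.
  inversion Hz as [| ? ? Hy Hz']; subst.
  destruct (half_form_factor _ _ _ H Hy) as (g & Hg & Hf).
  assert (D : is_derive f y (g y / 2)).
  { apply is_derive_ext with (fun x => sin ((x - y) / 2) * g x); auto.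
    auto_derive; [now apply half_form_ex_derive with (length l) |].
    replace ((y + - y) * / 2) with 0 by field; rewrite sin_0, cos_0; field. }
  apply is_derive_unique in D; rewrite H0 in D.
  apply Hx; rewrite Hf.
  rewrite (half_form_eq_0 (length l) g (y :: l)); auto; try ring.
  constructor; [lra |].
  inversion Hd as [| ? ? Hd1 Hd2]; subst.
  rewrite Forall_forall in *; intros y' Hy'.
  specialize (Hz' y' Hy'); rewrite Hf in Hz'.
  apply Rmult_integral in Hz'; destruct Hz' as [Hz' |]; auto.
  now elim (Hd1 y' Hy').
Qed.

(** * Trigonometric sums as half-angle forms *)

Lemma half_form_lift (m k : nat) (f : R -> R) :
  half_form m f -> half_form (2 * k + m) f.
Proof.
  intros H; induction k as [| k IH]; [exact H |].
  replace (2 * S k + m)%nat with (S (S (2 * k + m))) by lia.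
  (* Multiplication by [sin^2 + cos^2 = 1] raises the degree by two without changing the
     function. *)
  apply half_form_ext with
    (fun x => sin (x / 2) * (sin (x / 2) * f x)
              + cos (x / 2) * (cos (x / 2) * f x)).
  - intros x.
    transitivity ((Rsqr (sin (x / 2)) + Rsqr (cos (x / 2))) * f x);
      [unfold Rsqr; ring | rewrite sin2_cos2; ring].
  - apply half_form_plus.
    + now do 2 apply half_form_mul_sin.
    + now do 2 apply half_form_mul_cos.
Qed.

Lemma half_form_cos_sin (j : nat) :
  half_form (2 * j) (fun x => cos (INR j * x))
  /\ half_form (2 * j) (fun x => sin (INR j * x)).
Proof.
  induction j as [| j [IHc IHs]].
  - split; [apply half_form_O with 1 | apply half_form_O with 0];
      intros x; simpl; rewrite Rmult_0_l; [apply cos_0 | apply sin_0].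
  - replace (2 * S j)%nat with (S (S (2 * j))) by lia.
    assert (E : forall x, INR (S j) * x = INR j * x + 2 * (x / 2))
      by (intros x; rewrite S_INR; field).
    (* One step of the angle addition: [cos x] and [sin x] are quadratic forms in the half angle, so
       multiplying by them costs two degrees. *)
    assert (Q : forall f g, half_form (2 * j) f -> half_form (2 * j) g ->
      half_form (S (S (2 * j))) (fun x =>
        f x * cos (2 * (x / 2)) + g x * sin (2 * (x / 2)))).
    { intros f g Hf Hg.
      apply half_form_ext with
        (fun x => (cos (x / 2) * (cos (x / 2) * f x)
                   + (-1) * (sin (x / 2) * (sin (x / 2) * f x)))
                  + 2 * (sin (x / 2) * (cos (x / 2) * g x))).
      - intros x; rewrite cos_2a, sin_2a; ring.
      - repeat apply half_form_plus; repeat apply half_form_scal;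
          repeat (apply half_form_mul_cos || apply half_form_mul_sin); auto. }
    split.
    + apply half_form_ext with
        (fun x => cos (INR j * x) * cos (2 * (x / 2))
                  + (-1 * sin (INR j * x)) * sin (2 * (x / 2))).
      * intros x; rewrite E, cos_plus; ring.
      * apply (Q (fun x => cos (INR j * x)) (fun x => -1 * sin (INR j * x)));
          auto; now apply half_form_scal.
    + apply half_form_ext with
        (fun x => sin (INR j * x) * cos (2 * (x / 2))
                  + cos (INR j * x) * sin (2 * (x / 2))).
      * intros x; rewrite E, sin_plus; ring.
      * apply (Q (fun x => sin (INR j * x)) (fun x => cos (INR j * x))); auto.
Qed.

Definition trig_sum (n : nat) (a b : nat -> R) (x : R) : R :=
  a 0%nat
  + sum_n_m (fun j => a j * cos (INR j * x) + b j * sin (INR j * x)) 1 n.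

Lemma trig_sum_0 (a b : nat -> R) (x : R) : trig_sum 0 a b x = a 0%nat.
Proof.
  unfold trig_sum; rewrite sum_n_m_zero by lia; apply Rplus_0_r.
Qed.

Lemma trig_sum_S (n : nat) (a b : nat -> R) (x : R) :
  trig_sum (S n) a b x
  = trig_sum n a b x
    + (a (S n) * cos (INR (S n) * x) + b (S n) * sin (INR (S n) * x)).
Proof.
  unfold trig_sum; rewrite sum_n_Sm by lia.
  unfold plus; simpl AbelianMonoid.sort; cbn -[INR sum_n_m]; ring.
Qed.

Lemma trig_sum_half_form (n : nat) (a b : nat -> R) :
  half_form (2 * n) (trig_sum n a b).
Proof.
  induction n as [| n IH].
  - apply half_form_O with (a 0%nat); intros x; apply trig_sum_0.
  - eapply half_form_ext; [intros x; symmetry; apply trig_sum_S |].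
    destruct (half_form_cos_sin (S n)) as [Hc Hs].
    apply half_form_plus.
    + replace (2 * S n)%nat with (2 * 1 + 2 * n)%nat by lia.
      now apply half_form_lift.
    + now apply half_form_plus; apply half_form_scal.
Qed.

(** * Finite real sums; derivative and period of a trigonometric sum *)

Lemma sum_Rext (u v : nat -> R) (m n : nat) :
  (forall k, (m <= k <= n)%nat -> u k = v k) -> sum_n_m u m n = sum_n_m v m n :> R.
Proof. apply (sum_n_m_ext_loc u v). Qed.

Lemma sum_1_O (u : nat -> R) : sum_n_m u 1 0 = 0 :> R.
Proof. apply (sum_n_m_zero u); lia. Qed.

Lemma sum_1_S (u : nat -> R) (n : nat) :
  sum_n_m u 1 (S n) = sum_n_m u 1 n + u (S n) :> R.
Proof. apply (sum_n_Sm u); lia. Qed.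

Lemma sum_Rplus (u v : nat -> R) (m n : nat) :
  sum_n_m (fun k => u k + v k) m n = sum_n_m u m n + sum_n_m v m n :> R.
Proof. apply (sum_n_m_plus u v). Qed.

Lemma sum_Rmult (r : R) (u : nat -> R) (m n : nat) :
  sum_n_m (fun k => r * u k) m n = r * sum_n_m u m n :> R.
Proof. apply (sum_n_m_mult_l (K := R_Ring) r u). Qed.

Lemma sum_Rminus (u v : nat -> R) (m n : nat) :
  sum_n_m (fun k => u k - v k) m n = sum_n_m u m n - sum_n_m v m n :> R.
Proof.
  rewrite (sum_Rext _ (fun k => u k + (-1) * v k)) by (intros; simpl; ring).
  rewrite sum_Rplus, sum_Rmult; ring.
Qed.

Lemma sum_le_loc (u v : nat -> R) (n : nat) :
  (forall k, (1 <= k <= n)%nat -> u k <= v k) ->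
  sum_n_m u 1 n <= sum_n_m v 1 n.
Proof.
  induction n as [| n IH]; intros H; [rewrite !sum_1_O; lra |].
  rewrite !sum_1_S; apply Rplus_le_compat; [apply IH; intros |]; apply H; lia.
Qed.

Lemma sum_1_const (n : nat) (r : R) : sum_n_m (fun _ => r) 1 n = INR n * r :> R.
Proof. rewrite sum_n_m_const; do 2 f_equal; lia. Qed.

Lemma trig_sum_is_derive (n : nat) (a b : nat -> R) (x : R) :
  is_derive (trig_sum n a b) x
    (trig_sum n (fun j => INR j * b j) (fun j => - INR j * a j) x).
Proof.
  induction n as [| n IH].
  - rewrite trig_sum_0; simpl INR; rewrite Rmult_0_l.
    apply is_derive_ext with (fun _ => a 0%nat).
    + intros t; symmetry; apply trig_sum_0.
    + apply (@is_derive_const R_AbsRing R_NormedModule).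
  - rewrite trig_sum_S.
    apply is_derive_ext with (fun x => trig_sum n a b x
      + (a (S n) * cos (INR (S n) * x) + b (S n) * sin (INR (S n) * x))).
    + intros t; symmetry; apply trig_sum_S.
    + apply (@is_derive_plus R_AbsRing R_NormedModule); [exact IH |].
      generalize (INR (S n)); intros r; auto_derive; auto; ring.
Qed.

Lemma trig_sum_continuous (n : nat) (a b : nat -> R) (x : R) :
  continuous (trig_sum n a b) x.
Proof.
  apply (@ex_derive_continuous R_AbsRing R_NormedModule); eexists;
    apply trig_sum_is_derive.
Qed.

Lemma trig_sum_periodic (n : nat) (a b : nat -> R) (x : R) :
  trig_sum n a b (x + 2 * PI) = trig_sum n a b x.
Proof.
  unfold trig_sum; f_equal; apply sum_Rext; intros j _.
  replace (INR j * (x + 2 * PI)) with (INR j * x + 2 * INR j * PI) by ring.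
  now rewrite cos_period, sin_period.
Qed.

(** * The interpolation formula and Bernstein's inequality *)

(** For [1 <= k <= n] these are the zeros of [cos (n t)] in [(0, PI)]. *)
Definition riesz_node (n k : nat) : R := (2 * INR k - 1) * (PI / (2 * INR n)).

(** At a node the numerator is 1 or -1, with alternating sign in [k]; written as a sine, it combines
    directly with the addition formulas. *)
Definition riesz_weight (n k : nat) : R :=
  sin (INR n * riesz_node n k) / (1 - cos (riesz_node n k)).

Definition riesz (n : nat) (f : R -> R) (x : R) : R :=
  / (2 * INR n)
  * sum_n_m (fun k => riesz_weight n k
                      * (f (x + riesz_node n k) - f (x - riesz_node n k))) 1 n.

Lemma riesz_node_bounds (n k : nat) :
  (1 <= k <= n)%nat -> 0 < riesz_node n k < PI.
Proof.
  intros [Hk Hn]; unfold riesz_node; assert (Hpi := PI_RGT_0).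
  assert (H1 := le_INR 1 k Hk); simpl in H1.
  apply le_INR in Hn.
  assert (Hp : 0 < PI / (2 * INR n)) by (apply Rdiv_lt_0_compat; lra).
  split; [apply Rmult_lt_0_compat; lra |].
  replace PI with ((2 * INR n) * (PI / (2 * INR n))) at 2 by (field; lra).
  apply Rmult_lt_compat_r; lra.
Qed.

Lemma one_minus_cos_riesz_node (n k : nat) :
  (1 <= k <= n)%nat -> 0 < 1 - cos (riesz_node n k).
Proof.
  intros H; destruct (riesz_node_bounds n k H) as [H0 H1].
  assert (cos (riesz_node n k) < cos 0) by (apply cos_decreasing_1; lra).
  rewrite cos_0 in *; lra.
Qed.

Lemma cos_n_riesz_node (n k : nat) :
  (1 <= n)%nat -> cos (INR n * riesz_node n k) = 0.
Proof.
  intros Hn; apply le_INR in Hn; simpl in Hn; unfold riesz_node.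
  replace (INR n * ((2 * INR k - 1) * (PI / (2 * INR n))))
    with (- (PI / 2) + 2 * INR k * (PI / 2)) by (field; lra).
  induction k as [| k IH].
  - simpl INR; rewrite Rmult_0_r, Rmult_0_l, Rplus_0_r, cos_neg; apply cos_PI2.
  - rewrite S_INR.
    replace (- (PI / 2) + 2 * (INR k + 1) * (PI / 2))
      with ((- (PI / 2) + 2 * INR k * (PI / 2)) + PI) by field.
    rewrite neg_cos, IH; ring.
Qed.

(** The sum telescopes: [2 sin phi cos ((2k-1) phi) = sin (2k phi) - sin ((2k-2) phi)]. *)
Lemma sum_cos_odd (phi : R) (m : nat) :
  2 * sin phi * sum_n_m (fun k => cos ((2 * INR k - 1) * phi)) 1 m
  = sin (2 * INR m * phi).
Proof.
  induction m as [| m IH].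
  - rewrite sum_1_O; simpl; rewrite !Rmult_0_r, Rmult_0_l, sin_0; ring.
  - rewrite sum_1_S, Rmult_plus_distr_l, IH, S_INR.
    replace (2 * INR m * phi) with ((2 * (INR m + 1) - 1) * phi - phi) by ring.
    replace (2 * (INR m + 1) * phi) with ((2 * (INR m + 1) - 1) * phi + phi)
      by ring.
    rewrite sin_minus, sin_plus; ring.
Qed.

Lemma sum_cos_riesz_node (n i : nat) :
  (1 <= i < n)%nat ->
  sum_n_m (fun k => cos (INR i * riesz_node n k)) 1 n = 0 :> R.
Proof.
  intros [Hi Hn].
  apply le_INR in Hi; apply lt_INR in Hn; simpl in Hi.
  assert (Hpi := PI_RGT_0).
  (* With this angle the telescoped sum is [sin (i PI) = 0], while [0 < phi < PI / 2] makes the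
     factor [sin phi] nonzero. *)
  set (phi := INR i * (PI / (2 * INR n))).
  assert (E : phi = INR i / INR n * (PI / 2)) by (unfold phi; field; lra).
  assert (H0 : 0 < INR i / INR n < 1).
  { split; [apply Rdiv_lt_0_compat; lra |].
    apply Rmult_lt_reg_r with (INR n); [lra |].
    unfold Rdiv; rewrite Rmult_assoc, Rinv_l; lra. }
  assert (Hs : sin phi <> 0).
  { apply Rgt_not_eq, sin_gt_0; rewrite E.
    - apply Rmult_lt_0_compat; lra.
    - nra. }
  assert (H := sum_cos_odd phi n).
  replace (2 * INR n * phi) with (INR i * PI) in H by (unfold phi; field; lra).
  replace (sin (INR i * PI)) with 0 in H
    by (symmetry; apply sin_eq_0_1; exists (Z.of_nat i); now rewrite <- INR_IZR_INZ).
  apply Rmult_integral in H; destruct H as [H |]; [lra |].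
  rewrite <- H; apply sum_Rext; intros k _; f_equal.
  unfold phi, riesz_node; ring.
Qed.

(* Both sides are affine in [i]: the second difference of the left-hand side is
   [-2 * sum cos ((i+1) t_k) = 0], and it vanishes at [i = n]. *)
Lemma sum_cos_div_riesz_node (n i : nat) :
  (1 <= n)%nat -> (i <= n)%nat ->
  sum_n_m (fun k => cos (INR i * riesz_node n k) / (1 - cos (riesz_node n k))) 1 n
  = INR n * (INR n - INR i) :> R.
Proof.
  intros Hn.
  pose (c := (fun i => sum_n_m
    (fun k => cos (INR i * riesz_node n k) / (1 - cos (riesz_node n k))) 1 n) : nat -> R).
  (* Each of the [n] terms contributes [(cos t - 1) / (1 - cos t) = -1]. *)
  assert (H1 : c 1%nat = c 0%nat - INR n :> R).
  { replace (INR n) with (sum_n_m (fun _ => 1) 1 n) by (rewrite sum_1_const; apply Rmult_1_r).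
    unfold c; rewrite <- sum_Rminus; apply sum_Rext; intros k Hk.
    assert (H := one_minus_cos_riesz_node n k Hk).
    simpl INR; rewrite Rmult_1_l, Rmult_0_l, cos_0; field; lra. }
  (* The second difference of [cos (j t)] is [-2 cos ((j+1) t) (1 - cos t)], whose last factor
     cancels the denominator. *)
  assert (Hrec : forall j, (S j < n)%nat -> c (S (S j)) = 2 * c (S j) - c j :> R).
  { intros j Hj.
    assert (Hsum := sum_cos_riesz_node n (S j) ltac:(lia)).
    transitivity (2 * c (S j) - c j - 2 * 0); [| ring].
    rewrite <- Hsum; unfold c; rewrite <- !sum_Rmult, <- !sum_Rminus.
    apply sum_Rext; intros k Hk.
    assert (H := one_minus_cos_riesz_node n k Hk).
    set (t := riesz_node n k) in *.
    replace (INR (S (S j)) * t) with (INR (S j) * t + t)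
      by (rewrite (S_INR (S j)); ring).
    replace (INR j * t) with (INR (S j) * t - t) by (rewrite (S_INR j); ring).
    rewrite cos_plus, cos_minus; field; lra. }
  (* The recurrence has order two, so the induction carries two consecutive values. *)
  assert (Haff : forall j, (j <= n)%nat ->
    c j = c 0%nat - INR n * INR j :> R /\
    ((S j <= n)%nat -> c (S j) = c 0%nat - INR n * INR (S j) :> R)).
  { induction j as [| j IH]; intros Hj.
    - split; [simpl; ring | intros _; rewrite H1; simpl; ring].
    - destruct IH as [IH1 IH2]; [lia |]; split; [now apply IH2 |].
      intros Hj'; rewrite Hrec, IH1, IH2, !S_INR by lia; ring. }
  assert (Hcn : c n = 0 :> R).
  { transitivity (sum_n_m (fun _ => 0) 1 n); [| rewrite sum_1_const; apply Rmult_0_r].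
    apply sum_Rext; intros k _; rewrite cos_n_riesz_node by auto.
    unfold Rdiv; ring. }
  intros Hi; change (c i = INR n * (INR n - INR i)).
  assert (H := proj1 (Haff n (le_n n))).
  rewrite (proj1 (Haff i Hi)); lra.
Qed.

(** Since [cos (n t_k) = 0], the numerators have absolute value 1, and the sum is the preceding one
    at [i = 0]. *)
Lemma sum_abs_riesz_weight (n : nat) :
  (1 <= n)%nat ->
  sum_n_m (fun k => Rabs (riesz_weight n k)) 1 n = INR n * INR n :> R.
Proof.
  intros Hn.
  assert (H := sum_cos_div_riesz_node n 0 Hn ltac:(lia)).
  simpl INR in H; rewrite Rminus_0_r in H; rewrite <- H.
  apply sum_Rext; intros k Hk; unfold riesz_weight.
  assert (Hc := one_minus_cos_riesz_node n k Hk).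
  rewrite Rmult_0_l, cos_0, Rabs_div, (Rabs_pos_eq (1 - _)) by lra.
  f_equal.
  assert (Hs := sin2_cos2 (INR n * riesz_node n k)).
  rewrite cos_n_riesz_node in Hs by auto.
  rewrite Rsqr_0, Rplus_0_r in Hs; rewrite <- Rabs_R1; apply Rsqr_eq_abs_0.
  rewrite Hs; unfold Rsqr; ring.
Qed.

Lemma riesz_plus (n : nat) (f g : R -> R) (x : R) :
  riesz n (fun x => f x + g x) x = riesz n f x + riesz n g x.
Proof.
  unfold riesz; rewrite <- Rmult_plus_distr_l, <- sum_Rplus; f_equal.
  apply sum_Rext; intros k _; ring.
Qed.

Lemma riesz_ext (n : nat) (f g : R -> R) (x : R) :
  (forall y, f y = g y) -> riesz n f x = riesz n g x.
Proof.
  intros E; unfold riesz; f_equal; apply sum_Rext; intros k _; now rewrite !E.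
Qed.

(** The symmetric difference of the mode at step [t] is [2 sin (j t) (b cos (j x) - a sin (j x))].
    At a node, [sin (n t) sin (j t) = cos ((n - j) t)] because [cos (n t) = 0], so the sum over the
    nodes is the previous one at [n - j], namely [n j]. *)
Lemma riesz_mode (n j : nat) (a b x : R) :
  (1 <= n)%nat -> (j <= n)%nat ->
  riesz n (fun x => a * cos (INR j * x) + b * sin (INR j * x)) x
  = INR j * b * cos (INR j * x) + - INR j * a * sin (INR j * x).
Proof.
  intros Hn Hj; unfold riesz.
  assert (H := sum_cos_div_riesz_node n (n - j) Hn ltac:(lia)).
  rewrite minus_INR in H by auto.
  rewrite (sum_Rext _ (fun k =>
    2 * (b * cos (INR j * x) - a * sin (INR j * x))
    * (cos ((INR n - INR j) * riesz_node n k) / (1 - cos (riesz_node n k))))).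
  - rewrite sum_Rmult, H.
    apply le_INR in Hn; simpl in Hn; field; lra.
  - intros k Hk; unfold riesz_weight.
    assert (Hc := one_minus_cos_riesz_node n k Hk).
    rewrite Rmult_minus_distr_r, cos_minus, cos_n_riesz_node by auto.
    rewrite !Rmult_plus_distr_l, !Rmult_minus_distr_l.
    rewrite !cos_plus, !cos_minus, !sin_plus, !sin_minus; field; lra.
Qed.

Lemma riesz_interpolation (n : nat) (a b : nat -> R) (x : R) :
  (1 <= n)%nat ->
  trig_sum n (fun j => INR j * b j) (fun j => - INR j * a j) x
  = riesz n (trig_sum n a b) x.
Proof.
  intros Hn.
  (* Modes are added one at a time while the nodes and weights stay those of [n]. *)
  assert (H : forall m, (m <= n)%nat ->
    trig_sum m (fun j => INR j * b j) (fun j => - INR j * a j) x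
    = riesz n (trig_sum m a b) x).
  { induction m as [| m IH]; intros Hm.
    - rewrite trig_sum_0; simpl INR; rewrite Rmult_0_l; unfold riesz.
      transitivity (/ (2 * INR n) * sum_n_m (fun _ => 0) 1 n);
        [rewrite sum_1_const; ring |].
      f_equal; apply sum_Rext; intros k _; rewrite !trig_sum_0; ring.
    - rewrite trig_sum_S, IH, (riesz_ext _ _ _ _ (trig_sum_S m a b)) by lia.
      rewrite riesz_plus, riesz_mode by lia; ring. }
  now apply H.
Qed.

Lemma riesz_abs_le (n : nat) (f : R -> R) (x : R) :
  (1 <= n)%nat ->
  Rabs (riesz n f x)
  <= / (2 * INR n)
     * sum_n_m (fun k => Rabs (riesz_weight n k)
         * (Rabs (f (x + riesz_node n k)) + Rabs (f (x - riesz_node n k)))) 1 n.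
Proof.
  intros Hn; apply le_INR in Hn; simpl in Hn; unfold riesz.
  assert (Hi : 0 < / (2 * INR n)) by (apply Rinv_0_lt_compat; lra).
  rewrite Rabs_mult, (Rabs_pos_eq (/ _)) by lra.
  apply Rmult_le_compat_l; [lra |].
  eapply Rle_trans; [apply (@norm_sum_n_m R_AbsRing R_NormedModule) |].
  apply sum_n_m_le; intros k; change norm with Rabs; simpl.
  rewrite Rabs_mult; apply Rmult_le_compat_l; [apply Rabs_pos |].
  unfold Rminus at 1; eapply Rle_trans; [apply Rabs_triang |].
  rewrite Rabs_Ropp; lra.
Qed.

(** All nodes lie in [(0, PI)], so a bound at distance less than [PI] from [x] suffices. The
    weights, of total absolute value [n^2], meet the factor [2 M / (2 n)]. *)
Lemma bernstein_sup (n : nat) (f : R -> R) (M x : R) :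
  (1 <= n)%nat ->
  (forall t, -PI < t < PI -> Rabs (f (x + t)) <= M) ->
  Rabs (riesz n f x) <= INR n * M.
Proof.
  intros Hn HM; eapply Rle_trans; [now apply riesz_abs_le |].
  apply Rle_trans with
    (/ (2 * INR n) * sum_n_m (fun k => 2 * M * Rabs (riesz_weight n k)) 1 n).
  - apply Rmult_le_compat_l.
    + apply le_INR in Hn; simpl in Hn.
      apply Rlt_le, Rinv_0_lt_compat; lra.
    + apply sum_le_loc; intros k Hk.
      destruct (riesz_node_bounds n k Hk).
      rewrite Rmult_comm; apply Rmult_le_compat_r; [apply Rabs_pos |].
      assert (H1 := HM (riesz_node n k) ltac:(lra)).
      assert (H2 := HM (- riesz_node n k) ltac:(lra)).
      unfold Rminus; lra.
  - rewrite sum_Rmult, sum_abs_riesz_weight by auto.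
    apply le_INR in Hn; simpl in Hn.
    right; field; lra.
Qed.

(** * Integrals over a period and Bernstein's inequality in the mean *)

Lemma ex_RInt_cont (f : R -> R) (a b : R) :
  (forall x, continuous f x) -> ex_RInt f a b.
Proof. intros H; apply (@ex_RInt_continuous R_CompleteNormedModule); auto. Qed.

Lemma is_RInt_shift (f : R -> R) (v a b : R) :
  (forall x, continuous f x) ->
  is_RInt (fun x => f (x + v)) a b (RInt f (a + v) (b + v)).
Proof.
  intros H.
  assert (H1 : is_RInt (fun y => scal 1 (f (1 * y + v))) a b
                 (RInt f (1 * a + v) (1 * b + v))).
  { apply (@is_RInt_comp_lin R_NormedModule), (@RInt_correct R_CompleteNormedModule).
    now apply ex_RInt_cont. }
  rewrite !Rmult_1_l in H1.
  apply is_RInt_ext with (2 := H1); intros x _.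
  transitivity (f (1 * x + v)); [apply Rmult_1_l | now rewrite Rmult_1_l].
Qed.

Lemma RInt_Chasles_cont (f : R -> R) (a b c : R) :
  (forall x, continuous f x) -> RInt f a c = RInt f a b + RInt f b c.
Proof.
  intros H; symmetry.
  apply (@RInt_Chasles R_CompleteNormedModule); now apply ex_RInt_cont.
Qed.

Lemma RInt_periodic (f : R -> R) (T a : R) :
  (forall x, continuous f x) -> (forall x, f (x + T) = f x) ->
  RInt f a (a + T) = RInt f 0 T.
Proof.
  intros Hc HT.
  rewrite (RInt_Chasles_cont f a 0), (RInt_Chasles_cont f 0 T (a + T)) by auto.
  assert (H := is_RInt_unique _ _ _ _ (is_RInt_shift f T 0 a Hc)).
  rewrite (RInt_ext _ f) in H by auto.
  rewrite Rplus_0_l in H; rewrite <- H.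
  rewrite <- (opp_RInt_swap f 0 a) by now apply ex_RInt_cont.
  change (- RInt f 0 a + (RInt f 0 T + RInt f 0 a) = RInt f 0 T); ring.
Qed.

Lemma is_RInt_sum (u : nat -> R -> R) (v : nat -> R) (a b : R) (n : nat) :
  (forall k, (1 <= k <= n)%nat -> is_RInt (u k) a b (v k)) ->
  is_RInt (fun x => sum_n_m (fun k => u k x) 1 n) a b (sum_n_m v 1 n).
Proof.
  induction n as [| n IH]; intros H.
  - apply is_RInt_ext with (fun _ => 0).
    + intros x _; symmetry; apply sum_1_O.
    + rewrite sum_1_O.
      assert (H0 := @is_RInt_const R_NormedModule a b 0).
      change (scal (b - a) 0) with ((b - a) * 0) in H0.
      now rewrite Rmult_0_r in H0.
  - apply is_RInt_ext with (fun x => sum_n_m (fun k => u k x) 1 n + u (S n) x).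
    + intros x _; symmetry; apply (sum_1_S (fun k => u k x)).
    + rewrite sum_1_S; apply (@is_RInt_plus R_NormedModule); [apply IH; intros |];
        apply H; lia.
Qed.

(** Every translate of [|f|] has the same integral [I] over a period, so integrating the pointwise
    bound gives [n^2 * 2 I / (2 n)]. *)
Lemma bernstein_L1 (n : nat) (f : R -> R) (T : R) :
  (1 <= n)%nat -> 0 <= T ->
  (forall x, continuous f x) -> (forall x, f (x + T) = f x) ->
  ex_RInt (riesz n f) 0 T ->
  RInt (fun x => Rabs (riesz n f x)) 0 T
  <= INR n * RInt (fun x => Rabs (f x)) 0 T.
Proof.
  intros Hn HT Hc Hp Hex.
  set (I := RInt (fun x => Rabs (f x)) 0 T).
  assert (Hac : forall x, continuous (fun x => Rabs (f x)) x)
    by (intros x; now apply continuous_Rabs_comp).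
  assert (Hs : forall t, is_RInt (fun x => Rabs (f (x + t))) 0 T I).
  { intros t; assert (H := is_RInt_shift (fun x => Rabs (f x)) t 0 T Hac).
    rewrite Rplus_0_l, (Rplus_comm T), RInt_periodic in H; auto.
    intros x; now rewrite Hp. }
  assert (H : is_RInt (fun x => / (2 * INR n)
     * sum_n_m (fun k => Rabs (riesz_weight n k)
         * (Rabs (f (x + riesz_node n k)) + Rabs (f (x - riesz_node n k)))) 1 n)
     0 T (/ (2 * INR n)
          * sum_n_m (fun k => Rabs (riesz_weight n k) * (I + I)) 1 n)).
  { apply (@is_RInt_scal R_NormedModule).
    apply (is_RInt_sum (fun k x => Rabs (riesz_weight n k)
         * (Rabs (f (x + riesz_node n k)) + Rabs (f (x - riesz_node n k))))).
    intros k _; apply (@is_RInt_scal R_NormedModule).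
    apply (@is_RInt_plus R_NormedModule); [apply Hs | apply (Hs (- _))]. }
  apply Rle_trans with (/ (2 * INR n)
          * sum_n_m (fun k => Rabs (riesz_weight n k) * (I + I)) 1 n).
  - rewrite <- (is_RInt_unique _ _ _ _ H); apply RInt_le; auto.
    + now apply ex_RInt_norm.
    + eexists; exact H.
    + intros x _; now apply riesz_abs_le.
  - rewrite (sum_Rext _ (fun k => (I + I) * Rabs (riesz_weight n k)))
      by (intros; ring).
    rewrite sum_Rmult, sum_abs_riesz_weight by auto.
    apply le_INR in Hn; simpl in Hn; right; field; lra.
Qed.

(** Both end values are increments of [g] from its zero [c], bounded by the integrals of [|g'|] over
    the two pieces. *)
Lemma abs_ends_le_RInt (g g' : R -> R) (a b c : R) :
  (forall x, is_derive g x (g' x)) -> (forall x, continuous g' x) ->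
  a <= c <= b -> g c = 0 ->
  Rabs (g a) + Rabs (g b) <= RInt (fun x => Rabs (g' x)) a b.
Proof.
  intros Hd Hc Hacb Hgc.
  assert (H : forall u v, u <= v ->
    Rabs (g v - g u) <= RInt (fun x => Rabs (g' x)) u v).
  { intros u v Huv.
    assert (E : RInt g' u v = g v - g u).
    { apply is_RInt_unique.
      apply (@is_RInt_derive R_CompleteNormedModule g g'); auto. }
    rewrite <- E; apply abs_RInt_le; auto; now apply ex_RInt_cont. }
  rewrite (RInt_Chasles_cont _ a c b)
    by (intros x; now apply continuous_Rabs_comp).
  assert (H1 := H a c ltac:(lra)); assert (H2 := H c b ltac:(lra)).
  rewrite Hgc, Rminus_0_r in *.
  rewrite Rminus_0_l, Rabs_Ropp in H1; lra.
Qed.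

(** * Variation of the derivative between zeros *)

Definition list_sum_R (l : list R) : R := fold_right Rplus 0 l.

(* By Rolle, [f'] vanishes between consecutive zeros of [f]; hence the variation
   of [f'] there is at least the sum of the values of [|f'|] at both zeros. *)
Lemma sum_abs_derive_at_zeros (f f' f'' : R -> R) (l : list R) (a b : R) :
  (forall x, is_derive f x (f' x)) -> (forall x, is_derive f' x (f'' x)) ->
  (forall x, continuous f'' x) ->
  StronglySorted Rlt (a :: l) -> (forall y, In y (a :: l) -> y < b) ->
  (forall y, In y (a :: l) -> f y = 0) -> f b = 0 ->
  Rabs (f' a) + 2 * list_sum_R (map (fun y => Rabs (f' y)) l) + Rabs (f' b)
  <= RInt (fun x => Rabs (f'' x)) a b.
Proof.
  intros D1 D2 Hc.
  assert (Hstep : forall u v, u < v -> f u = 0 -> f v = 0 ->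
    Rabs (f' u) + Rabs (f' v) <= RInt (fun x => Rabs (f'' x)) u v).
  { intros u v Huv Hu Hv.
    destruct (MVT_cor2 f f' u v Huv) as (c & Hfc & Hcuv).
    { intros x _; apply is_derive_Reals; auto. }
    apply abs_ends_le_RInt with c; auto; [lra |].
    rewrite Hu, Hv, Rminus_0_r in Hfc; symmetry in Hfc.
    apply Rmult_integral in Hfc; lra. }
  (* An interior zero ends one gap and starts the next, hence the factor 2 on [l] only. *)
  revert a; induction l as [| y l IH]; intros a Hs Hb Hz Hfb.
  - simpl; assert (H := Hstep a b (Hb a (or_introl eq_refl))
      (Hz a (or_introl eq_refl)) Hfb); lra.
  - apply StronglySorted_inv in Hs; destruct Hs as [Hs Hay].
    inversion Hay as [| ? ? Hay' _]; subst.
    assert (H1 := Hstep a y Hay' (Hz a (or_introl eq_refl))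
      (Hz y (or_intror (or_introl eq_refl)))).
    assert (H2 := IH y Hs (fun w Hw => Hb w (or_intror Hw))
      (fun w Hw => Hz w (or_intror Hw)) Hfb).
    rewrite (RInt_Chasles_cont _ a y b)
      by (intros x; now apply continuous_Rabs_comp).
    simpl; fold (list_sum_R (map (fun y => Rabs (f' y)) l)); lra.
Qed.

(** * Sorting the zeros, and their simplicity *)

Lemma StronglySorted_insert (x : R) (l : list R) :
  ~ In x l -> StronglySorted Rlt l ->
  exists l', Permutation (x :: l) l' /\ StronglySorted Rlt l'.
Proof.
  induction l as [| y l IH]; intros Hx Hs.
  - exists (x :: nil); split; auto; repeat constructor.
  - destruct (Rtotal_order x y) as [H | [H | H]].
    + exists (x :: y :: l); split; auto; constructor; auto.
      apply StronglySorted_inv in Hs; destruct Hs as [_ Hy].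
      constructor; auto.
      rewrite Forall_forall in *; intros w Hw; specialize (Hy w Hw); lra.
    + elim Hx; left; auto.
    + apply StronglySorted_inv in Hs; destruct Hs as [Hs Hy].
      destruct IH as (l' & Hp & Hl'); auto.
      { intros Hi; apply Hx; now right. }
      exists (y :: l'); split.
      * rewrite perm_swap; now constructor.
      * constructor; auto; rewrite Forall_forall in *; intros w Hw.
        apply Permutation_sym in Hp; apply (Permutation_in _ Hp) in Hw.
        destruct Hw as [<- | Hw]; auto.
Qed.

Lemma StronglySorted_exists (l : list R) :
  NoDup l -> exists l', Permutation l l' /\ StronglySorted Rlt l'.
Proof.
  induction 1 as [| x l Hx Hl (l' & Hp & Hs)].
  - exists nil; split; constructor.
  - destruct (StronglySorted_insert x l') as (l'' & Hp' & Hs'); auto.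
    + intros Hi; apply Hx; now apply Permutation_in with l'; [symmetry |].
    + exists l''; split; auto; rewrite <- Hp'; now constructor.
Qed.

Lemma list_sum_R_Permutation (l l' : list R) :
  Permutation l l' -> list_sum_R l = list_sum_R l'.
Proof. induction 1; simpl in *; lra. Qed.

Lemma sum_list_sum_R (u : nat -> R) (n : nat) :
  sum_n_m u 1 n = list_sum_R (map u (seq 1 n)) :> R.
Proof.
  induction n as [| n IH]; [apply sum_1_O |].
  rewrite sum_1_S, IH, seq_S, map_app; symmetry.
  assert (H : forall l r, list_sum_R (l ++ r :: nil) = list_sum_R l + r)
    by (intros l r; induction l; simpl in *; lra).
  apply H.
Qed.

(** Half the difference of two distinct points of [[0, 2 PI)] lies in [(-PI, PI)] and is nonzero. *)
Lemma NoDup_sin_half_diff (l : list R) :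
  NoDup l -> (forall y, In y l -> 0 <= y < 2 * PI) ->
  ForallOrdPairs (fun y y' => sin ((y' - y) / 2) <> 0) l.
Proof.
  induction 1 as [| y l Hy Hl IH]; intros Hr; constructor.
  - rewrite Forall_forall; intros y' Hy'.
    assert (H1 := Hr y (or_introl eq_refl)).
    assert (H2 := Hr y' (or_intror Hy')).
    destruct (Rtotal_order y y') as [H | [-> | H]]; [| contradiction |].
    + apply Rgt_not_eq, sin_gt_0; lra.
    + apply Rlt_not_eq, sin_lt_0_var; lra.
  - apply IH; intros y' Hy'; apply Hr; now right.
Qed.

(** As a half-angle form of degree [2 n], a nonzero sum already attains the maximal number of zeros
    on [l], which leaves no room for a multiple one. *)
Lemma trig_sum_simple_zero (n : nat) (a b : nat -> R) (l : list R) (y : R) :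
  length l = (2 * n)%nat -> NoDup l -> (forall y, In y l -> 0 <= y < 2 * PI) ->
  (forall y, In y l -> trig_sum n a b y = 0) ->
  (exists x, trig_sum n a b x <> 0) ->
  In y l -> Derive (trig_sum n a b) y <> 0.
Proof.
  intros Hl Hnd Hr Hz Hx Hy.
  destruct (in_split _ _ Hy) as (l1 & l2 & ->).
  assert (Hp : Permutation (l1 ++ y :: l2) (y :: l1 ++ l2))
    by (symmetry; apply Permutation_middle).
  assert (Hlen := Permutation_length Hp); rewrite Hl in Hlen; simpl in Hlen.
  apply half_form_simple_zero with (length (l1 ++ l2)) (l1 ++ l2); auto.
  - rewrite <- Hlen; apply trig_sum_half_form.
  - apply NoDup_sin_half_diff; [now apply (Permutation_NoDup Hp) |].
    intros w Hw; apply Hr; now apply Permutation_in with (1 := Permutation_sym Hp).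
  - rewrite Forall_forall; intros w Hw; apply Hz.
    now apply Permutation_in with (1 := Permutation_sym Hp).
Qed.

(** * The lower bounds for the supremum and the integral *)

Theorem theorem1p13 (n : nat) (P : R -> R) (z : nat -> R)
  (hn : (1 <= n)%nat)
  (hP : trig_poly_of_degree n P)
  (hz_range : forall k : nat, (1 <= k <= 2 * n)%nat -> 0 <= z k < 2 * PI)
  (hz_zero : forall k : nat, (1 <= k <= 2 * n)%nat -> P (z k) = 0)
  (hz_distinct : forall k l : nat, (1 <= k <= 2 * n)%nat ->
     (1 <= l <= 2 * n)%nat -> z k = z l -> k = l) :
  Rbar_le 2 (Lub_Rbar (fun y : R =>
     exists x : R, 0 <= x < 2 * PI /\ y = node_sum n P z x))
  /\ 8 <= RInt (fun x : R => node_sum n P z x) 0 (2 * PI).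
Proof.
  destruct hP as [(a & b & HP) (x0 & Hx0)].
  change (forall x, P x = trig_sum n a b x) in HP.
  assert (Hpi := PI_RGT_0).
  assert (HN : 1 <= INR n) by (apply (le_INR 1 n); auto).
  set (a1 := fun j => INR j * b j); set (b1 := fun j => - INR j * a j).
  set (a2 := fun j => INR j * b1 j); set (b2 := fun j => - INR j * a1 j).
  set (T := trig_sum n a b); set (T1 := trig_sum n a1 b1);
    set (T2 := trig_sum n a2 b2).
  assert (D1 : forall x, is_derive T x (T1 x)) by apply trig_sum_is_derive.
  assert (D2 : forall x, is_derive T1 x (T2 x)) by apply trig_sum_is_derive.
  assert (R1 : forall x, T1 x = riesz n T x)
    by (intros x; now apply riesz_interpolation).
  assert (R2 : forall x, T2 x = riesz n T1 x)
    by (intros x; now apply riesz_interpolation).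
  assert (DP : forall x, Derive P x = T1 x).
  { intros x; rewrite (Derive_ext _ _ _ HP); now apply is_derive_unique. }
  set (zs := map z (seq 1 (2 * n))).
  assert (Hin : forall y, In y zs -> exists k, (1 <= k <= 2 * n)%nat /\ y = z k).
  { intros y Hy; apply in_map_iff in Hy; destruct Hy as (k & <- & Hk).
    apply in_seq in Hk; exists k; split; auto; lia. }
  assert (Hlen : length zs = (2 * n)%nat)
    by (unfold zs; now rewrite length_map, length_seq).
  assert (Hnd : NoDup zs).
  { apply NoDup_map_NoDup_ForallPairs; [| apply seq_NoDup].
    intros k l Hk Hl; apply in_seq in Hk; apply in_seq in Hl.
    apply hz_distinct; lia. }
  assert (Hr : forall y, In y zs -> 0 <= y < 2 * PI)
    by (intros y Hy; destruct (Hin y Hy) as (k & Hk & ->); auto).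
  assert (Hz : forall y, In y zs -> T y = 0)
    by (intros y Hy; destruct (Hin y Hy) as (k & Hk & ->);
        unfold T; rewrite <- HP; auto).
  set (d := fun k => Rabs (T1 (z k))).
  assert (Hd : forall k, (1 <= k <= 2 * n)%nat -> 0 < d k).
  { intros k Hk; apply Rabs_pos_lt.
    rewrite <- (is_derive_unique _ _ _ (D1 (z k))).
    apply trig_sum_simple_zero with zs; auto.
    - exists x0; now rewrite <- HP.
    - apply in_map, in_seq; lia. }
  set (S := sum_n_m (fun k => / d k) 1 (2 * n) : R).
  (* Only the factor [|T x|] depends on [x], so both claims reduce to lower bounds for [S]. *)
  assert (Hnode : forall x, node_sum n P z x = S * Rabs (T x)).
  { intros x; unfold node_sum, S; rewrite (Rmult_comm _ (Rabs _)), <- sum_Rmult.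
    apply sum_Rext; intros k _; rewrite HP, DP; reflexivity. }
  assert (H2n : INR (2 * n) = 2 * INR n) by (rewrite mult_INR; reflexivity).
  assert (HS : 0 < S).
  { unfold S; replace (2 * n)%nat with (Datatypes.S (2 * n - 1)) by lia.
    rewrite sum_1_S; apply Rplus_le_lt_0_compat.
    - replace 0 with (sum_n_m (fun _ => 0) 1 (2 * n - 1))
        by (rewrite sum_1_const; apply Rmult_0_r).
      apply sum_le_loc; intros k Hk; apply Rlt_le, Rinv_0_lt_compat, Hd; lia.
    - apply Rinv_0_lt_compat, Hd; lia. }
  split.
  - destruct (Lub_Rbar_correct (fun y : R =>
      exists x : R, 0 <= x < 2 * PI /\ y = node_sum n P z x)) as [Hub _].
    destruct (Lub_Rbar _) as [L | |]; simpl; auto.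
    (* A finite supremum [L] bounds [|T|] by [L / S]; an infinite one needs no argument. *)
    + set (M := L / S).
      assert (HM0 : forall x, 0 <= x < 2 * PI -> Rabs (T x) <= M).
      { intros x Hx; apply Rmult_le_reg_l with S; auto.
        unfold M; replace (S * (L / S)) with L by (field; lra).
        rewrite <- Hnode; apply (Hub (node_sum n P z x)); now exists x. }
      (* The range is widened by a period on each side to contain all points within [PI] of a
         zero. *)
      assert (HM : forall x, - (2 * PI) <= x < 4 * PI -> Rabs (T x) <= M).
      { intros x Hx; destruct (Rlt_or_le x 0).
        - unfold T; rewrite <- trig_sum_periodic; apply HM0; lra.
        - destruct (Rlt_or_le x (2 * PI)); [apply HM0; lra |].
          replace x with ((x - 2 * PI) + 2 * PI) by ring.
          unfold T; rewrite trig_sum_periodic; apply HM0; lra. }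
      assert (Hdk : forall k, (1 <= k <= 2 * n)%nat -> d k <= INR n * M).
      { intros k Hk; unfold d; rewrite R1; apply bernstein_sup; auto.
        intros t Ht; apply HM; assert (H := hz_range k Hk); lra. }
      assert (HnM : 0 < INR n * M)
        by (apply Rlt_le_trans with (d 1%nat); [apply Hd | apply Hdk]; lia).
      assert (HM1 : 0 < M) by (apply Rmult_lt_reg_l with (INR n); lra).
      assert (HSM : 2 / M <= S).
      { replace (2 / M) with (INR (2 * n) * / (INR n * M))
          by (rewrite H2n; field; lra).
        rewrite <- sum_1_const; apply sum_le_loc; intros k Hk.
        apply Rinv_le_contravar; auto. }
      replace L with (S * M) by (unfold M; field; lra).
      replace 2 with (2 / M * M) by (field; lra).
      apply Rmult_le_compat_r; lra.
    (* The supremum of a nonempty set of reals is not minus infinity. *)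
    + apply (Hub (node_sum n P z 0)); exists 0; split; auto; lra.
  - set (I := RInt (fun x => Rabs (T x)) 0 (2 * PI)).
    replace (RInt _ 0 (2 * PI)) with (S * I).
    2:{ rewrite (RInt_ext _ _ _ _ (fun x _ => Hnode x)); symmetry.
        apply (@RInt_scal R_CompleteNormedModule), ex_RInt_cont.
        intros x; apply continuous_Rabs_comp, trig_sum_continuous. }
    set (D := sum_n_m d 1 (2 * n) : R).
    assert (HDI : 2 * D <= INR n * (INR n * I)).
    { destruct (StronglySorted_exists zs Hnd) as (l & Hp & Hs).
      assert (Hp' := Permutation_sym Hp).
      assert (HD : D = list_sum_R (map (fun y => Rabs (T1 y)) l)).
      { unfold D; rewrite sum_list_sum_R.
        rewrite <- (list_sum_R_Permutation _ _ (Permutation_map _ Hp)).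
        unfold zs; now rewrite map_map. }
      assert (Hl := Permutation_length Hp); rewrite Hlen in Hl.
      destruct l as [| w l]; [simpl in Hl; lia |].
      assert (Hw : In w zs) by (apply (Permutation_in _ Hp'); now left).
      (* The period is taken from the least zero [w] to its translate, also a zero. The two end
         terms agree by periodicity, so the left-hand side becomes [2 * D]. *)
      assert (HV := sum_abs_derive_at_zeros T T1 T2 l w (w + 2 * PI) D1 D2
        (trig_sum_continuous _ _ _) Hs).
      assert (Hper : Rabs (T1 (w + 2 * PI)) = Rabs (T1 w))
        by (unfold T1; now rewrite trig_sum_periodic).
      rewrite Hper in HV.
      rewrite HD; simpl; fold (list_sum_R (map (fun y => Rabs (T1 y)) l)).
      apply Rle_trans with (RInt (fun x => Rabs (T2 x)) w (w + 2 * PI)).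
      { match goal with |- ?x <= _ => match type of HV with
          | _ -> _ -> _ -> ?y <= _ => replace x with y by ring end end.
        apply HV.
        - intros y Hy; apply (Permutation_in _ Hp') in Hy.
          assert (H1 := Hr y Hy); assert (H2 := Hr w Hw); lra.
        - intros y Hy; apply Hz, (Permutation_in _ Hp'), Hy.
        - unfold T; rewrite trig_sum_periodic; auto. }
      rewrite RInt_periodic.
      2:{ intros x; apply continuous_Rabs_comp, trig_sum_continuous. }
      2:{ intros x; unfold T2; now rewrite trig_sum_periodic. }
      rewrite (RInt_ext _ (fun x => Rabs (riesz n T1 x)))
        by (intros x _; now rewrite R2).
      assert (HE : forall g h, (forall x, h x = riesz n g x) ->
        (forall x, continuous h x) -> ex_RInt (riesz n g) 0 (2 * PI)).
      { intros g h E Hh; apply ex_RInt_ext with h; auto; now apply ex_RInt_cont. }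
      (* Bernstein's inequality is used twice, from [T2] to [T1] and then from [T1] to [T]. *)
      eapply Rle_trans; [apply bernstein_L1; auto; try lra |].
      + apply trig_sum_continuous.
      + apply trig_sum_periodic.
      + apply HE with T2; auto; apply trig_sum_continuous.
      + apply Rmult_le_compat_l; [lra |].
        rewrite (RInt_ext _ (fun x => Rabs (riesz n T x)))
          by (intros x _; now rewrite R1).
        apply bernstein_L1; auto; try lra.
        * apply trig_sum_continuous.
        * apply trig_sum_periodic.
        * apply HE with T1; auto; apply trig_sum_continuous. }
    assert (HD0 : 0 < D).
    { unfold D; replace (2 * n)%nat with (Datatypes.S (2 * n - 1)) by lia.
      rewrite sum_1_S; apply Rplus_le_lt_0_compat; [| apply Hd; lia].
      replace 0 with (sum_n_m (fun _ => 0) 1 (2 * n - 1))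
        by (rewrite sum_1_const; apply Rmult_0_r).
      apply sum_le_loc; intros k Hk; apply Rlt_le, Hd; lia. }
    (* tangent line of [1/d] at the mean [D / (2n)] *)
    assert (HSD : 4 * (INR n * INR n) / D <= S).
    { set (tau := D / (2 * INR n)).
      assert (Htau : 0 < tau) by (apply Rdiv_lt_0_compat; lra).
      apply Rle_trans with
        (sum_n_m (fun k => 2 / tau - / (tau * tau) * d k) 1 (2 * n)).
      - rewrite sum_Rminus, sum_1_const, sum_Rmult, H2n; fold D.
        right; unfold tau; field; lra.
      - apply sum_le_loc; intros k Hk; assert (H := Hd k Hk).
        assert (E : / d k - (2 / tau - / (tau * tau) * d k)
                    = (d k - tau) * (d k - tau) * / (d k * (tau * tau)))
          by (field; lra).
        assert (0 <= (d k - tau) * (d k - tau) * / (d k * (tau * tau))).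
        { apply Rmult_le_pos; [apply Rle_0_sqr |].
          apply Rlt_le, Rinv_0_lt_compat.
          apply Rmult_lt_0_compat; [| apply Rmult_lt_0_compat]; auto. }
        lra. }
    (* Multiplied by [D], the first inequality is four times [HDI]. *)
    apply Rle_trans with (4 * (INR n * INR n) / D * I).
    + apply Rmult_le_reg_r with D; auto.
      replace (4 * (INR n * INR n) / D * I * D) with (4 * (INR n * (INR n * I)))
        by (field; lra).
      lra.
    + apply Rmult_le_compat_r; auto.
      apply RInt_ge_0; [lra | | intros x _; apply Rabs_pos].
      apply ex_RInt_cont; intros x.
      apply continuous_Rabs_comp, trig_sum_continuous.
Qed.
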